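(* Let $f\colon\mathbb{R}^d\to\mathbb{R}$ be a CPWL function that is compatible with a regular polyhedral complex $\mathcal{C}$ with $\tilde q=\#\mathcal{C}^d$ full-dimensional polyhedra. Then $f$ can be represented by a neural network with $\lceil\log_2(d+1)\rceil+\lceil\log_2 r\rceil$ many hidden layers and overall size $\mathcal{O}(rs^{d+1})$, for any free choice of positive integer parameters $r$ and $s$ with $rs\ge\tilde q$.
   Context: A polyhedral complex $\mathcal{C}$ in $\mathbb{R}^d$ is a finite collection of polyhedra containing $\emptyset$, closed under taking faces, such that the intersection of any two members is a face of both; it is complete if the union of its members is $\mathbb{R}^d$; $\mathcal{C}^d$ is the set of its $d$-dimensional members. A function $f\colon\mathbb{R}^d\to\mathbb{R}$ is continuous and piecewise linear (CPWL) if there is a complete polyhedral complex $\mathcal{C}$ such that the restriction of $f$ to each member of $\mathcal{C}$ is affine linear; in this case $f$ and $\mathcal{C}$ are called compatible. A convex CPWL function $g$ can be written as the maximum $g(x)=\max_{i\in[k]}(\langle a_i,x\rangle+b_i)$ of its linear components (the distinct affine functions with which $g$ agrees on full-dimensional regions); it has a unique coarsest compatible polyhedral complex $\mathcal{C}_g$, whose full-dimensional members are the sets $\{x\in\mathbb{R}^d\mid\langle a_i,x\rangle+b_i=g(x)\}$, $i\in[k]$. A polyhedral complex $\mathcal{C}$ is regular if $\mathcal{C}=\mathcal{C}_g$ for some convex CPWL function $g$. A neural network (with rectified linear unit, ReLU, activations) with $\ell\ge0$ hidden layers is defined by a sequence of affine transformations $T_i\colon\mathbb{R}^{n_{i-1}}\to\mathbb{R}^{n_i}$,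 $i=1,\dots,\ell+1$, with $n_0=d$ and $n_{\ell+1}=1$. It represents (computes) the function $T_{\ell+1}\circ\sigma\circ T_\ell\circ\sigma\circ\dots\circ\sigma\circ T_1$, where $\sigma$ applies $x\mapsto\max\{x,0\}$ in each component. Its size is $\sum_{i=1}^{\ell}n_i$. *)

(* Defs.v *)
From mathcomp Require Import all_boot all_order all_algebra.
From mathcomp Require Import boolp classical_sets functions cardinality reals.
From mathcomp Require Import convex.

Set Implicit Arguments.
Unset Strict Implicit.
Unset Printing Implicit Defensive.

Import Order.TTheory GRing.Theory Num.Theory.
Local Open Scope classical_set_scope.
Local Open Scope ring_scope.

Section PolyhedralComplexes.
Context {R : realType} {d : nat}.
Implicit Types (P F : set 'cV[R]_d) (C D : set (set 'cV[R]_d)).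
Implicit Types (f g : 'cV[R]_d -> R).

Definition dot (a x : 'cV[R]_d) : R := \sum_(i < d) a i 0 * x i 0.

(* The empty set and the whole space are polyhedra. *)
Definition polyhedron P : Prop :=
  exists (m : nat) (A : 'M[R]_(m, d)) (b : 'cV[R]_m),
    P = [set x | forall i, (A *m x) i 0 <= b i 0].

(* Taking a = 0 shows that set0 and P itself are faces of P. *)
Definition face F P : Prop :=
  exists (a : 'cV[R]_d) (c : R),
    (forall x, P x -> dot a x <= c) /\ F = P `&` [set x | dot a x = c].

(* U is the linear space parallel to the affine hull of P. *)
Definition direction_space P (U : {vspace 'cV[R]_d}) : Prop :=
  (forall x y, P x -> P y -> x - y \in U) /\
  (forall V : {vspace 'cV[R]_d},
     (forall x y, P x -> P y -> x - y \in V) -> (U <= V)%VS).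

(* set0 has no dimension in nat, so for d = 0 only the point is
   full-dimensional. *)
Definition has_dim P (k : nat) : Prop :=
  P !=set0 /\ exists2 U, direction_space P U & \dim U = k.

Definition polyhedral_complex C : Prop :=
  [/\ finite_set C,
      C set0,
      forall P, C P -> polyhedron P,
      forall P F, C P -> face F P -> C F
    & forall P Q, C P -> C Q -> face (P `&` Q) P /\ face (P `&` Q) Q].

Definition complete C : Prop := \bigcup_(P in C) P = setT.

Definition full_dim C : set (set 'cV[R]_d) := [set P | C P /\ has_dim P d].

Definition affine_on P f : Prop :=
  exists (a : 'cV[R]_d) (b : R), forall x, P x -> f x = dot a x + b.

Definition compatible f C : Prop :=
  [/\ polyhedral_complex C, complete C & forall P, C P -> affine_on P f].

Definition cpwl f : Prop := exists C, compatible f C.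

Definition refines D C : Prop :=
  forall P, D P -> exists2 Q, C Q & P `<=` Q.

Definition coarsest_compatible g C : Prop :=
  compatible g C /\ (forall D, compatible g D -> refines D C).

Definition regular C : Prop :=
  exists g, [/\ cpwl g, convex_function setT g & coarsest_compatible g C].

End PolyhedralComplexes.

Section NeuralNetworks.
Context {R : realType}.

Record affine_map (n m : nat) := AffineMap {
  weights : 'M[R]_(m, n);
  bias : 'cV[R]_m }.

Definition affine_eval n m (T : affine_map n m) (x : 'cV[R]_n) : 'cV[R]_m :=
  weights T *m x + bias T.

Definition relu n (x : 'cV[R]_n) : 'cV[R]_n := map_mx (Num.max 0) x.

(* relu_net n is the type of networks with n inputs and one output; the
   affine maps are listed from the input side, one Hidden per hidden layer. *)
Inductive relu_net : nat -> Type :=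
| Output n of affine_map n 1 : relu_net n
| Hidden n m of affine_map n m & relu_net m : relu_net n.

Fixpoint net_eval n (N : relu_net n) : 'cV[R]_n -> R :=
  match N in relu_net n return 'cV[R]_n -> R with
  | Output _ T => fun x => affine_eval T x 0 0
  | Hidden _ _ T N' => fun x => net_eval N' (relu (affine_eval T x))
  end.

Fixpoint hidden_layers n (N : relu_net n) : nat :=
  match N with
  | Output _ _ => 0%N
  | Hidden _ _ _ N' => (hidden_layers N').+1
  end.

Fixpoint net_size n (N : relu_net n) : nat :=
  match N with
  | Output _ _ => 0%N
  | Hidden _ m _ N' => (m + net_size N')%N
  end.

End NeuralNetworks.

Arguments affine_map : clear implicits.
Arguments relu_net : clear implicits.

(* Main.v *)
Require Import Defs.
From mathcomp Require Import all_boot all_order all_algebra.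
From mathcomp Require Import boolp classical_sets functions cardinality reals.
From mathcomp Require Import interval_inference convex.
From mathcomp Require Import ring lra zify.

Set Implicit Arguments.
Unset Strict Implicit.
Unset Printing Implicit Defensive.

Import Order.TTheory GRing.Theory Num.Theory.
Local Open Scope classical_set_scope.
Local Open Scope ring_scope.

(** Write [G] for the convex function that defines the regular complex.  Two
    ideas combine.

    First, [f] is a difference of two convex functions with the same few
    pieces as [G].  If two cells of [G] meet, Farkas' lemma bounds the jump
    between the pieces of [f] by a multiple of the jump between those of [G]
    ([adjacent_dominate]).  So for large [c] the function [f + c G] bends
    upwards at every passage between cells, and following a segment shows
    that it is the maximum of its pieces ([pieces_dominate]).  Regularity
    enters because distinct full-dimensional members of the complex carry
    distinct pieces of [G]: otherwise the complex formed by the regions where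
    a piece attains the maximum would be compatible with [G] without refining
    the given one ([cell_complexP], [regular_pieces]).  Hence
    [f = (f + c G) - c G] is a difference of two maxima of [q] affine
    functions.

    Second, a maximum of [r s] affine functions has a network of the required
    depth and size.  Split it into [r] groups of [s].  If more than [d + 1]
    affine functions in dimension [d] are given, an affine dependence of their
    gradients yields a vanishing alternating sum of maxima over subsets, which
    expresses the maximum of all by maxima of fewer ([setmax_reduction]).  So
    each group maximum is a linear combination of at most [s ^ (d + 1)] maxima
    of [d + 1] functions ([setmax_lspan]).  Tournaments compute those in
    logarithmic depth in [d + 1], linear combinations are free, and a final
    tournament between the [r] groups adds logarithmic depth in [r]
    ([computable_max_grouped]). *)

(** * Affine functions *)

Section Affine.
Context {R : realType} {d : nat}.
Implicit Types (a x y w : 'cV[R]_d) (p q : 'cV[R]_d * R).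

Lemma dotDl a b x : dot (a + b) x = dot a x + dot b x.
Proof. by rewrite -big_split; apply: eq_bigr => i _; rewrite mxE mulrDl. Qed.

Lemma dotZl c a x : dot (c *: a) x = c * dot a x.
Proof. by rewrite mulr_sumr; apply: eq_bigr => i _; rewrite mxE mulrA. Qed.

Lemma dotC a x : dot a x = dot x a.
Proof. by apply: eq_bigr => i _; rewrite mulrC. Qed.

Lemma dotDr a x y : dot a (x + y) = dot a x + dot a y.
Proof. by rewrite dotC dotDl !(dotC a). Qed.

Lemma dotZr c a x : dot a (c *: x) = c * dot a x.
Proof. by rewrite dotC dotZl (dotC a). Qed.

Lemma dot0l x : dot 0 x = 0.
Proof. by rewrite -(scale0r (0 : 'cV_d)) dotZl mul0r. Qed.

Lemma dotNl a x : dot (- a) x = - dot a x.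
Proof. by rewrite -scaleN1r dotZl mulN1r. Qed.

Lemma dotNr a x : dot a (- x) = - dot a x.
Proof. by rewrite dotC dotNl dotC. Qed.

Lemma dotBl a b x : dot (a - b) x = dot a x - dot b x.
Proof. by rewrite dotDl dotNl. Qed.

Lemma dotBr a x y : dot a (x - y) = dot a x - dot a y.
Proof. by rewrite dotDr dotNr. Qed.

Lemma dot_suml (I : Type) (r : seq I) (P : pred I) (F : I -> 'cV[R]_d) x :
  dot (\sum_(i <- r | P i) F i) x = \sum_(i <- r | P i) dot (F i) x.
Proof.
by apply: (big_morph (fun a => dot a x)); [move=> *; exact: dotDl|exact: dot0l].
Qed.

Lemma dot_sumr (I : Type) (r : seq I) (P : pred I) (F : I -> 'cV[R]_d) a :
  dot a (\sum_(i <- r | P i) F i) = \sum_(i <- r | P i) dot a (F i).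
Proof. by rewrite dotC dot_suml; apply: eq_bigr => i _; rewrite dotC. Qed.

Lemma dot_delta a i : dot a (delta_mx i 0) = a i 0.
Proof.
rewrite /dot (bigD1 i) //= mxE !eqxx mulr1 big1 ?addr0 // => j ji.
by rewrite mxE (negPf ji) mulr0.
Qed.

Lemma dot_inj a b : (forall x, dot a x = dot b x) -> a = b.
Proof.
by move=> E; apply/matrixP => i j; rewrite ord1 -!dot_delta E.
Qed.

Definition aff (p : 'cV[R]_d * R) x : R := dot p.1 x + p.2.

Lemma aff_line p y w t : aff p (y + t *: w) = aff p y + t * dot p.1 w.
Proof. by rewrite /aff dotDr dotZr addrAC. Qed.

Lemma affB p q x : aff (p - q) x = aff p x - aff q x.
Proof. by rewrite /aff dotBl /= addrACA opprD. Qed.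

Lemma aff0 x : aff 0 x = 0.
Proof. by rewrite /aff dot0l addr0. Qed.

Lemma aff_sum (I : finType) (P : pred I) (p : I -> 'cV[R]_d * R) x :
  aff (\sum_(i | P i) p i) x = \sum_(i | P i) aff (p i) x.
Proof.
apply: (big_morph (fun p => aff p x)) => [q r|]; last exact: aff0.
by rewrite /aff dotDl /= addrACA.
Qed.

End Affine.
(** * Families of functions computed by a common network *)

Section Layers.
Context {R : realType} {d : nat}.
Local Notation func := ('cV[R]_d -> R).
Implicit Types (S : set func) (phi : func).

(** The linear span, generated inductively so that closure properties of
    spans are proved by induction; pointwise equations take the place of
    equalities of functions. *)
Inductive lspan S : set func :=
| lspan_mem phi : S phi -> lspan S phi
| lspan_zero phi : (forall x, phi x = 0) -> lspan S phi
| lspan_scale_add phi psi chi (c : R) : lspan S phi -> lspan S psi ->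
    (forall x, chi x = c * phi x + psi x) -> lspan S chi.

Lemma lspan_sum S (T : Type) (r : seq T) (c : T -> R) (F : T -> func) phi :
  (forall t, lspan S (F t)) -> (forall x, phi x = \sum_(t <- r) c t * F t x) ->
  lspan S phi.
Proof.
move=> SF; elim: r phi => [|t r IH] phi Hphi.
  by apply: lspan_zero => x; rewrite Hphi big_nil.
have Sr := IH (fun x => \sum_(t <- r) c t * F t x) (fun _ => erefl).
by apply: (lspan_scale_add (c := c t) (SF t) Sr) => x; rewrite Hphi big_cons.
Qed.

(** What an affine output layer can read off a layer of rectified units. *)
Definition relu_span m (g : 'I_m -> func) : set func :=
  [set phi | exists (c : 'I_m -> R) (b : R),
     forall x, phi x = \sum_i c i * Num.max 0 (g i x) + b].

Lemma lspan_trans S S' phi : S `<=` lspan S' -> lspan S phi -> lspan S' phi.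
Proof.
move=> sS; elim=> {phi} [phi /sS //|phi p0|phi psi chi c _ p _ q E].
  exact: lspan_zero.
exact: lspan_scale_add p q E.
Qed.

(** One network with [L] hidden layers and at most [Z] hidden neurons computes
    all functions of [S] simultaneously: each of them is an affine combination
    of the units of the last hidden layer.  Speaking of a set of functions
    keeps widths and indices out of the parallel composition of networks. *)
Fixpoint computable (L Z : nat) S : Prop :=
  if L is L'.+1 then
    exists m (g : 'I_m -> func),
      [/\ (m <= Z)%N, computable L' (Z - m) (range g) & S `<=` relu_span g]
  else forall phi, S phi -> affine_on setT phi.

Lemma computable_sub L Z Z' S S' :
  (Z <= Z')%N -> S' `<=` S -> computable L Z S -> computable L Z' S'.
Proof.
elim: L Z Z' S S' => [|L IH] Z Z' S S' leZ sS /=; first by move=> aS phi /sS/aS.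
move=> [m [g [mZ cg Sg]]]; exists m, g; split; first exact: leq_trans leZ.
  by apply: IH cg => //; rewrite leq_sub2r.
exact: subset_trans Sg.
Qed.

(** The output layer is affine, so linear combinations cost neither layers nor
    neurons. *)
Lemma computable_lspan L Z S : computable L Z S -> computable L Z (lspan S).
Proof.
case: L => [|L] /=.
  move=> aS phi; elim=> {phi} [|phi p0|phi psi chi c _ [a [b E]] _ [a' [b' E']] H].
  - exact: aS.
  - by exists 0, 0 => x _; rewrite p0 dot0l addr0.
  - exists (c *: a + a'), (c * b + b') => x _.
    by rewrite H E // E' // dotDl dotZl mulrDr addrACA.
move=> [m [g [mZ cg Sg]]]; exists m, g; split=> // phi.
elim=> {phi} [|phi p0|phi psi chi c _ [a [b E]] _ [a' [b' E']] H].
- exact: Sg.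
- by exists (fun=> 0), 0 => x; rewrite p0 big1 ?addr0 // => i _; rewrite mul0r.
- exists (fun i => c * a i + a' i), (c * b + b') => x.
  rewrite H E E' mulrDr mulr_sumr addrACA -big_split; congr (_ + _).
  by apply: eq_bigr => i _ /=; rewrite mulrA -mulrDl.
Qed.

Lemma computable_relu L Z S (T : finType) (G : T -> func) :
  computable L Z S -> (forall t, S (G t)) ->
  computable L.+1 (Z + #|T|) (range (fun t x => Num.max 0 (G t x))).
Proof.
move=> cS SG; exists #|T|, (G \o enum_val); split; first exact: leq_addl.
  by rewrite addnK; apply: computable_sub cS => // _ [t _ <-] /=.
move=> _ [t _ <-]; exists (fun i => (i == enum_rank t)%:R), 0 => x.
rewrite addr0 (bigD1 (enum_rank t)) //= eqxx mul1r enum_rankK big1 ?addr0 //.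
by move=> i /negPf->; rewrite mul0r.
Qed.

(** Two networks of equal depth run side by side. *)
Lemma computableU L Z1 Z2 S1 S2 : computable L Z1 S1 -> computable L Z2 S2 ->
  computable L (Z1 + Z2) (S1 `|` S2).
Proof.
elim: L Z1 Z2 S1 S2 => [|L IH] Z1 Z2 S1 S2 /=.
  by move=> a1 a2 phi [/a1|/a2].
move=> [m1 [g1 [mZ1 cg1 Sg1]]] [m2 [g2 [mZ2 cg2 Sg2]]].
pose g i := match fintype.split i with inl j => g1 j | inr j => g2 j end.
have gl j : g (lshift m2 j) = g1 j by rewrite /g (unsplitK (inl _)).
have gr j : g (rshift m1 j) = g2 j by rewrite /g (unsplitK (inr _)).
exists (m1 + m2)%N, g; split; first exact: leq_add.
  have -> : (Z1 + Z2 - (m1 + m2) = (Z1 - m1) + (Z2 - m2))%N by lia.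
  apply: computable_sub (IH _ _ _ _ cg1 cg2) => // _ [i _ <-].
  by rewrite /g; case: fintype.split => j; [left|right]; exists j.
move=> phi [/Sg1|/Sg2] [c [b E]].
- exists (fun i => if fintype.split i is inl j then c j else 0), b => x.
  rewrite E big_split_ord /= [X in _ + X + _]big1 ?addr0.
    congr (_ + _); apply: eq_bigr => j _.
    by rewrite gl (unsplitK (inl _)).
  by move=> j _; rewrite (unsplitK (inr _)) mul0r.
- exists (fun i => if fintype.split i is inr j then c j else 0), b => x.
  rewrite E big_split_ord /= [X in _ = X + _ + _]big1 ?add0r.
    congr (_ + _); apply: eq_bigr => j _.
    by rewrite gr (unsplitK (inr _)).
  by move=> j _; rewrite (unsplitK (inl _)) mul0r.
Qed.

Lemma computable_set0 L Z : computable L Z set0.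
Proof.
elim: L => [|L IH]; first by [].
exists 0%N, (fun _ _ => 0); split=> //.
by rewrite subn0; apply: computable_sub IH => // phi [[]].
Qed.

Lemma computable_bigU (T : finType) L Z (S : T -> set func) :
  (forall t, computable L Z (S t)) ->
  computable L (#|T| * Z) (\bigcup_t S t).
Proof.
move=> cS; suff H (r : seq T) (D : set T) : (forall t, D t -> t \in r) ->
    computable L (size r * Z) (\bigcup_(t in D) S t).
  by rewrite cardE; apply: H; move=> t tT; rewrite mem_enum.
elim: r D => [|t r IH] D Dr.
  have -> : \bigcup_(t in D) S t = set0.
    by rewrite bigcup0 // => t /Dr.
  exact: computable_set0.
rewrite /= mulSn.
apply: computable_sub (computableU (cS t) (IH (D `\ t) _)) => //.
  move=> phi [u Du Su]; have [<-|ut] := eqVneq u t; [by left|right].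
  by exists u => //; split => //= /eqP; rewrite (negPf ut).
by move=> u [/Dr]; rewrite inE => /predU1P[-> []|].
Qed.

(** [max a b = relu (a - b) + relu b - relu (- b)], hence three neurons for
    each pair. *)
Lemma computable_max2 L Z S (T : finType) (A B : T -> func) :
  computable L Z S -> (forall t, S (A t)) -> (forall t, S (B t)) ->
  computable L.+1 (Z + 3 * #|T|) (range (fun t x => Num.max (A t x) (B t x))).
Proof.
move=> cS SA SB.
pose G (u : T + T + T) x := match u with
  | inl (inl t) => A t x - B t x | inl (inr t) => B t x | inr t => - B t x end.
have SG u : lspan S (G u).
  have S0 : lspan S (fun=> 0) by exact: lspan_zero.
  case: u => [[]|] t.
  - apply: (lspan_scale_add (c := -1) (lspan_mem (SB t)) (lspan_mem (SA t))).
    by move=> x /=; rewrite mulN1r addrC.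
  - exact: (lspan_mem (SB t)).
  - apply: (lspan_scale_add (c := -1) (lspan_mem (SB t)) S0).
    by move=> x /=; rewrite mulN1r addr0.
have := computable_lspan (computable_relu (computable_lspan cS) SG).
apply: computable_sub; first by rewrite !card_sum; lia.
move=> _ [t _ <-].
pose c (u : T + T + T) : R := if u is inr _ then -1 else 1.
apply: (@lspan_sum _ _ [:: inl (inl t); inl (inr t); inr t] c
   (fun u x => Num.max 0 (G u x))).
  by move=> u; apply: lspan_mem; exists u.
move=> x; rewrite !big_cons big_nil /= /c.
by case: (leP (A t x) (B t x)) => ?; case: (leP 0 (A t x - B t x)) => ?;
  case: (leP 0 (B t x)) => ?; case: (leP 0 (- B t x)) => ?; lra.
Qed.

(** A relation instead of a big operator, so that maxima over index types of
    different shape can be compared without reindexing. *)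
Definition is_max (I : Type) (h : I -> func) (M : func) : Prop :=
  forall x, (forall i, h i x <= M x) /\ exists i, M x = h i x.

Lemma is_max_uniq (I : Type) (h : I -> func) M M' :
  is_max h M -> is_max h M' -> M = M'.
Proof.
move=> maxM maxM'; apply/funext => x; apply/le_anti.
have [Mge [i Mi]] := maxM x; have [Mge' [i' Mi']] := maxM' x.
by rewrite {1}Mi Mge' Mi' Mge.
Qed.

Lemma is_max_exists (I : finType) (h : I -> func) (i0 : I) :
  exists M, is_max h M.
Proof.
exists (fun x => \big[Num.max/h i0 x]_i h i x) => x; split=> [i|].
  exact: le_bigmax.
apply: (big_ind (fun y => exists i, y = h i x)); first by exists i0.
- by move=> _ _ [i ->] [j ->]; rewrite maxEle; case: ifP; [exists j|exists i].
- by move=> i _; exists i.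
Qed.

(** A tournament: every hidden layer halves the number of competitors, and the
    widths form a geometric series. *)
Lemma computable_max_pow2 k L Z S (F : nat -> func) M :
  computable L Z S -> (forall i, (i < 2 ^ k)%N -> S (F i)) ->
  is_max (fun i : 'I_(2 ^ k) => F i) M ->
  computable (L + k) (Z + 3 * 2 ^ k) [set M].
Proof.
elim: k L Z S F => [|k IH] L Z S F cS SF maxM.
  rewrite addn0; apply: computable_sub cS; first exact: leq_addr.
  move=> _ ->; suff -> : M = F 0%N by exact: SF.
  by apply/funext => x; have [_ [[[|i] ltik] ->]] := maxM x.
pose G i x := Num.max (F i x) (F (i + 2 ^ k)%N x).
have SF' (i : 'I_(2 ^ k)) : S (F i) /\ S (F (i + 2 ^ k)%N).
  by have := ltn_ord i; split; apply: SF; rewrite expnS; lia.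
have := computable_max2 cS (fun i => (SF' i).1) (fun i => (SF' i).2).
rewrite card_ord => cG.
have {cG} := IH _ _ _ G cG.
rewrite addSnnS -addnA -mulnDr addnn -mul2n -expnS; apply.
  by move=> i ltik; exists (Ordinal ltik).
move=> x; have [Mge [i Mi]] := maxM x; split.
  move=> j; have ltj := ltn_ord j; rewrite /G ge_max.
  have j1 : (j < 2 ^ k.+1)%N by rewrite expnS; lia.
  have j2 : (j + 2 ^ k < 2 ^ k.+1)%N by rewrite expnS; lia.
  by rewrite (Mge (Ordinal j1)) (Mge (Ordinal j2)).
have lti : (i < 2 * 2 ^ k)%N by rewrite -expnS.
have [ik|ki] := ltnP i (2 ^ k)%N.
  exists (Ordinal ik); apply/le_anti; rewrite {1}Mi /G le_max lexx /= ge_max.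
  have j1 : (i + 2 ^ k < 2 ^ k.+1)%N by rewrite [X in (_ < X)%N]expnS; lia.
  by rewrite (Mge i) (Mge (Ordinal j1)).
have ik : (i - 2 ^ k < 2 ^ k)%N by lia.
exists (Ordinal ik); apply/le_anti; rewrite {1}Mi /G /= subnK // le_max lexx.
have j1 : (i - 2 ^ k < 2 ^ k.+1)%N by rewrite [X in (_ < X)%N]expnS; lia.
by rewrite orbT /= ge_max (Mge i) (Mge (Ordinal j1)).
Qed.

Lemma exp_up_log_le n : (0 < n)%N -> (2 ^ up_log 2 n <= 2 * n)%N.
Proof.
case: n => [//|[|n]] _; first by rewrite up_log1.
have /andP[+ _] := @up_log_bounds 2 n.+2 isT isT.
have : (0 < up_log 2 n.+2)%N by rewrite up_log_gt0.
by case: up_log => //= k _; rewrite expnS; lia.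
Qed.

(** The competitors are padded to a power of two by repeating the last one,
    which at most doubles their number. *)
Lemma computable_max n L Z S (h : 'I_n -> func) :
  computable L Z S -> (forall i, S (h i)) ->
  computable (L + up_log 2 n) (Z + 6 * n) (is_max h).
Proof.
move=> cS Sh; have [[M maxM]|noM] := pselect (exists M, is_max h M); last first.
  by apply: computable_sub (computable_set0 _ 0) => // M maxM; case: noM; exists M.
case: n h Sh maxM => [|n] h Sh maxM; first by have [_ [[]]] := maxM 0.
have ltu (i : 'I_n.+1) : (i < 2 ^ up_log 2 n.+1)%N.
  exact: leq_trans (ltn_ord i) (@up_logP 2 n.+1 isT).
have maxM' : is_max (fun i : 'I_(2 ^ up_log 2 n.+1) => h (inord (minn i n))) M.
  move=> x; have [Mge [i Mi]] := maxM x; split=> //.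
  exists (Ordinal (ltu i)); rewrite Mi; congr (h _ x); apply/val_inj => /=.
  by have := ltn_ord i; rewrite inordK ?ltnS ?geq_minr //; lia.
have cM := computable_max_pow2 cS (fun i _ => Sh (inord (minn i n))) maxM'.
apply: computable_sub cM; first by have := @exp_up_log_le n.+1 isT; lia.
by move=> M' maxM''; exact: is_max_uniq maxM'' maxM.
Qed.

Definition comp_affine n m k (U : affine_map R m k) (T : affine_map R n m) :=
  AffineMap (weights U *m weights T) (weights U *m bias T + bias U).

Lemma comp_affineE n m k (U : affine_map R m k) (T : affine_map R n m) x :
  affine_eval (comp_affine U T) x = affine_eval U (affine_eval T x).
Proof. by rewrite /affine_eval /= mulmxDr mulmxA addrA. Qed.

Lemma precomp_affine n m (T : affine_map R n m) (N : relu_net R m) :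
  exists N' : relu_net R n,
    [/\ forall x, net_eval N' x = net_eval N (affine_eval T x),
        hidden_layers N' = hidden_layers N & net_size N' = net_size N].
Proof.
case: N T => [m' U|m' k U N] T.
  by exists (Output (comp_affine U T)); split=> // x; rewrite /= comp_affineE.
by exists (Hidden (comp_affine U T) N); split=> // x; rewrite /= comp_affineE.
Qed.

(** The passage from [computable] back to networks, built from the output
    side: [N] is the part of the network already constructed. *)
Lemma computable_prefix L Z m (g : 'I_m -> func) (N : relu_net R m) :
  computable L Z (range g) ->
  exists N' : relu_net R d,
    [/\ forall x, net_eval N' x = net_eval N (\col_i g i x),
        hidden_layers N' = (L + hidden_layers N)%N
      & (net_size N' <= Z + net_size N)%N].
Proof.
elim: L Z m g N => [|L IH] Z m g N /=.
  move=> ga; have /choice [ab gE] : forall i : 'I_m, exists ab : 'cV[R]_d * R,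
      forall x, g i x = dot ab.1 x + ab.2.
    move=> i; have [|a [b E]] := ga (g i); first by exists i.
    by exists (a, b) => x; apply: E.
  pose T := AffineMap (\matrix_(i, j) (ab i).1 j 0) (\col_i (ab i).2).
  have [N' [evN' lN' sN']] := precomp_affine T N.
  exists N'; split=> //; last by rewrite sN' leq_addl.
  move=> x; rewrite evN'; congr (net_eval N _); apply/matrixP => i j.
  rewrite ord1 !mxE gE; congr (_ + _).
  by apply: eq_bigr => k _; rewrite !mxE.
move=> [m' [g' [mZ cg' sg']]].
have /choice [cb gE] : forall i : 'I_m, exists cb : ('I_m' -> R) * R,
    forall x, g i x = \sum_j cb.1 j * Num.max 0 (g' j x) + cb.2.
  move=> i; have [|c [b E]] := sg' (g i); first by exists i.
  by exists (c, b).
pose T := AffineMap (\matrix_(i, j) (cb i).1 j) (\col_i (cb i).2).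
have [N1 [evN1 lN1 sN1]] := precomp_affine T N.
have [N' [evN' lN' sN']] := IH _ _ g' (Hidden (AffineMap 1%:M 0) N1) cg'.
exists N'; split; last by rewrite /= sN1 in sN'; lia.
  move=> x; rewrite evN' /= evN1; congr (net_eval N _); apply/matrixP => i j.
  rewrite ord1 /affine_eval /= mul1mx addr0 !mxE gE; congr (_ + _).
  by apply: eq_bigr => k _; rewrite !mxE.
by rewrite lN' /= lN1; lia.
Qed.

Lemma computable_net L Z phi : computable L Z [set phi] ->
  exists N : relu_net R d,
    [/\ forall x, net_eval N x = phi x, hidden_layers N = L
      & (net_size N <= Z)%N].
Proof.
move=> cphi; have c1 : computable L Z (range (fun _ : 'I_1 => phi)).
  by apply: computable_sub cphi => // _ [_ _ <-].
have [N [evN lN sN]] := computable_prefix (Output (AffineMap 1%:M 0)) c1.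
rewrite /= !addn0 in lN sN; exists N; split=> // x.
by rewrite evN /= /affine_eval /= mul1mx addr0 mxE.
Qed.

End Layers.
(** * Maxima of affine functions in dimension d *)

Section MaxOfAffine.
Context {R : realType} {d : nat}.
Local Notation func := ('cV[R]_d -> R).

Section SetMax.
Context {I : finType} (h : I -> func).
Implicit Types (A C T : {set I}) (x : 'cV[R]_d).

(** A lower bound of the family serves as default of the maximum, which makes
    [setmax T] the true maximum over every nonempty [T], without a
    distinguished element of [T]. *)
Definition lower x : R := \big[Num.min/0]_i h i x.
Definition setmax T x : R := \big[Num.max/lower x]_(i in T) h i x.

Lemma setmaxU1 a T x : setmax (a |: T) x = Num.max (h a x) (setmax T x).
Proof.
rewrite /setmax bigmaxU bigmax_set1 -maxA; congr Num.max.
by apply/max_idPr; exact: bigmax_ge_id.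
Qed.

Lemma le_setmax T i x : i \in T -> h i x <= setmax T x.
Proof. by move=> iT; exact: le_bigmax_cond. Qed.

Lemma setmax_sub C T x : C \subset T -> setmax C x <= setmax T x.
Proof. by move=> CT; apply: sub_bigmax => i; apply/fintype.subsetP. Qed.

Lemma setmax_attained T i0 x : i0 \in T -> exists2 i, i \in T & setmax T x = h i x.
Proof.
move=> i0T; rewrite /setmax (bigmax_eq_arg _ _ _ _ i0T) => [|i _];
  last exact: bigmin_le.
by case: Order.TotalTheory.arg_maxP => // i iT _; exists i.
Qed.

(** Adding [a] to [T] or removing it does not change the maximum over [T :|: C]
    at [x], but it flips the sign, so the terms cancel in pairs. *)
Lemma alternating_setmax A C a x : a \in A -> h a x <= setmax C x ->
  \sum_(T : {set I} | T \subset A) (-1) ^+ #|T| * setmax (T :|: C) x = 0.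
Proof.
move=> aA haC; set s := \sum_(_ | _) _.
pose tog T := if a \in T then T :\ a else a |: T.
have togK : involutive tog.
  move=> T; rewrite /tog; case aT: (a \in T);
    first by rewrite finset.setD11 finset.setD1K.
  by rewrite finset.setU11 finset.setU1K // aT.
suff : s = - s by move=> ?; lra.
rewrite {1}/s (reindex_inj (inv_inj togK)) /= -sumrN.
apply: eq_big => T.
  rewrite /tog; case aT: (a \in T);
    last by rewrite finset.subUset finset.sub1set aA.
  by rewrite -{2}(finset.setD1K aT) finset.subUset finset.sub1set aA.
move=> _; rewrite -mulNr.
have absorb U : setmax (a |: U :|: C) x = setmax (U :|: C) x.
  rewrite -finset.setUA setmaxU1; apply/max_idPr; apply: le_trans haC _.
  exact/setmax_sub/finset.subsetUr.
rewrite /tog; case aT: (a \in T).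
  by rewrite -{3 4}(finset.setD1K aT) absorb
    cardsU1 !inE eqxx /= exprS mulN1r opprK.
by rewrite absorb cardsU1 aT exprS mulN1r.
Qed.

End SetMax.

(** More than [d + 1] vectors of dimension [d], extended by a coordinate [1],
    are linearly dependent. *)
Lemma affine_dependence n (a : 'I_n -> 'cV[R]_d) (S : {set 'I_n}) :
  (d.+1 < #|S|)%N ->
  exists mu : 'I_n -> R,
    [/\ forall i, i \notin S -> mu i = 0, exists i, mu i != 0,
        \sum_i mu i = 0 & \sum_i mu i *: a i = 0].
Proof.
move=> ltS.
pose B : 'M[R]_(#|S|, 1 + d) :=
  row_mx (const_mx 1) (\matrix_(i, j) a (enum_val i) j 0).
have : kermx B != 0.
  rewrite kermx_eq0 /row_free neq_ltn; apply/orP; left.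
  by apply: leq_ltn_trans ltS; exact: rank_leq_col.
case/rowV0Pn => v /sub_kermxP; rewrite mul_mx_row -row_mx0.
move=> /eq_row_mx [v1 va] /eqP/rowP/existsNP [k /eqP vk].
pose mu i := \sum_(k : 'I_#|S|) if enum_val k == i then v 0 k else 0.
have muE (V : lmodType R) (F : 'I_n -> V) :
    \sum_i mu i *: F i = \sum_(k : 'I_#|S|) v 0 k *: F (enum_val k).
  rewrite (eq_bigr _ (fun i _ => scaler_suml _ _ _ _)) exchange_big /=.
  apply: eq_bigr => k' _; rewrite (bigD1 (enum_val k')) //= eqxx big1 ?addr0 //.
  by move=> i /negPf; rewrite eq_sym => ->; rewrite scale0r.
exists mu; split.
- move=> i iS; rewrite /mu big1 // => k' _; case: eqP => // k'i.
  by rewrite -k'i enum_valP in iS.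
- exists (enum_val k); rewrite /mu (bigD1 k) //= eqxx big1 ?addr0.
    by rewrite mxE in vk.
  by move=> k' k'k; rewrite (inj_eq enum_val_inj) (negPf k'k).
- have := muE R^o (fun=> 1); rewrite (eq_bigr mu) => [->|i _]; last exact: mulr1.
  have /matrixP/(_ 0 0) := v1; rewrite !mxE; apply: etrans.
  by apply: eq_bigr => k' _; rewrite mxE.
- rewrite muE; apply/matrixP => i j; rewrite ord1 summxE.
  have /matrixP/(_ 0 i) := va; rewrite !mxE; apply: etrans.
  by apply: eq_bigr => k' _; rewrite !mxE.
Qed.

Lemma sum0_pos (I : finType) (mu : I -> R) :
  \sum_i mu i = 0 -> (exists i, mu i != 0) -> exists i, 0 < mu i.
Proof.
move=> mu1 [i mui]; apply: contrapT => npos.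
have le0 j : mu j <= 0 by rewrite leNgt; apply/negP => ?; apply: npos; exists j.
have /eqP : \sum_j - mu j = 0 by rewrite sumrN mu1 oppr0.
rewrite psumr_eq0 => [/allP/(_ i)|j _]; last by rewrite oppr_ge0.
by rewrite mem_index_enum oppr_eq0 (negPf mui) => /(_ isT).
Qed.

(** An affine dependence [mu] makes [\sum_i mu i * h i] a constant, which may
    be taken nonpositive by changing the sign of [mu].  If [A] is the set of
    indices with [mu] positive, then at no point can all [h i], [i] in [A],
    exceed the maximum over the remaining indices [C].  So the alternating
    sum over the subsets of [A] vanishes at every point, and it expresses its
    term [T = A], the maximum over [S], by maxima over proper subsets. *)
Lemma setmax_reduction n (p : 'I_n -> 'cV[R]_d * R) (h := fun i => aff (p i))
    (S : {set 'I_n}) :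
  (d.+1 < #|S|)%N ->
  lspan [set phi | exists T : {set 'I_n},
                    [/\ T \proper S, T != finset.set0 & phi = setmax h T]]
        (setmax h S).
Proof.
move=> ltS; pose a i := (p i).1; pose b i := (p i).2.
have [mu [muS mu0 mu1 mua mub]] : exists mu : 'I_n -> R,
    [/\ forall i, i \notin S -> mu i = 0, exists i, mu i != 0,
        \sum_i mu i = 0, \sum_i mu i *: a i = 0 & \sum_i mu i * b i <= 0].
  have [mu [muS [i mui] mu1 mua]] := affine_dependence a ltS.
  have [mub|/ltW mub] := leP (\sum_i mu i * b i) 0.
    by exists mu; split=> //; exists i.
  exists (fun i => - mu i); split.
  - by move=> j /muS->; rewrite oppr0.
  - by exists i; rewrite oppr_eq0.
  - by rewrite sumrN mu1 oppr0.
  - by under eq_bigr do rewrite scaleNr; rewrite sumrN mua oppr0.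
  - by rewrite -oppr_ge0 -sumrN; under eq_bigr do rewrite mulNr opprK.
pose A := finset (fun i => 0 < mu i).
pose C := S :\: A.
have AS : A \subset S.
  by apply/fintype.subsetP => i; rewrite inE; apply: contraTT => /muS->;
    rewrite ltxx.
have [i0 i0C] : exists i0, i0 \in C.
  have [||i] := @sum0_pos _ (fun i => - mu i).
  - by rewrite sumrN mu1 oppr0.
  - by have [i mui] := mu0; exists i; rewrite oppr_eq0.
  rewrite oppr_gt0 => mui; exists i; rewrite !inE -leNgt ltW //=.
  by apply: contraTT mui => /muS->; rewrite ltxx.
have absorb x : exists2 i, i \in A & h i x <= setmax h C x.
  apply: contrapT => noA; pose m := setmax h C x.
  have hA i : 0 < mu i -> m < h i x.
    by move=> mui; rewrite ltNge; apply/negP => him; apply: noA;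
      exists i => //; rewrite inE.
  have : 0 < \sum_i mu i * (h i x - m).
    have [i mui] := sum0_pos mu1 mu0.
    rewrite (bigD1 i) //= ltr_pwDl ?mulr_gt0 ?subr_gt0 ?hA // sumr_ge0 // => j _.
    have [muj|muj] := leP (mu j) 0; last by rewrite mulr_ge0 ?subr_ge0 ?ltW // hA.
    have [jS|/muS->] := boolP (j \in S); last by rewrite mul0r.
    by rewrite mulr_le0 // subr_le0 le_setmax // !inE -leNgt muj.
  rewrite ltNge => /negP; apply; apply: le_trans mub.
  rewrite (eq_bigr (fun i => mu i * dot (a i) x + mu i * b i - mu i * m)).
    rewrite big_split /= sumrN -mulr_suml mu1 mul0r subr0 big_split /=.
    rewrite (eq_bigr (fun i => dot (mu i *: a i) x)) => [|i _];
      last by rewrite dotZl.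
    by rewrite -dot_suml mua dot0l add0r.
  by move=> i _; rewrite /h /aff mulrBr mulrDr.
have SAC : S = A :|: C by rewrite -{1}(finset.setID S A) (finset.setIidPr AS).
(* the coefficients that result from solving the alternating sum for T = A *)
pose cf (T : {set 'I_n}) : R := - (-1) ^+ #|A| * (-1) ^+ #|T|.
pose F (T : {set 'I_n}) := if T \proper A then setmax h (T :|: C) else fun=> 0.
apply: (@lspan_sum _ _ _ _ (index_enum {set 'I_n}) cf F) => [T|x].
  rewrite /F; case: ifP => TA; last exact: lspan_zero.
  apply: lspan_mem; exists (T :|: C); split=> //.
    have /fintype.properP [sTA [i iA iT]] := TA.
    apply/fintype.properP; split; first by rewrite SAC finset.setSU.
    exists i; first exact: (fintype.subsetP AS).
    by rewrite finset.in_setU negb_or iT finset.in_setD iA.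
  by apply/finset.set0Pn; exists i0; rewrite inE i0C orbT.
have [i iA hi] := absorb x.
have := alternating_setmax iA hi; rewrite (bigD1 A) //= -SAC => /eqP.
rewrite addr_eq0 => /eqP /(congr1 ( *%R ((-1) ^+ #|A|))).
rewrite mulrA -exprD addnn -mul2n exprM sqrrN !expr1n mul1r => ->.
rewrite mulrN -mulNr mulr_sumr big_mkcond /=; apply: eq_bigr => T _.
rewrite /F finset.properEneq andbC; case: ifP => _; last by rewrite mulr0.
by rewrite mulrA.
Qed.

(** Iterating the reduction leaves maxima of at most [d + 1] functions.
    Describing these by maps from [d + 1] indices, possibly with repetitions,
    bounds the number of terms by [n ^ (d + 1)]. *)
Lemma setmax_lspan n (p : 'I_n -> 'cV[R]_d * R) (h := fun i => aff (p i))
    (S : {set 'I_n}) :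
  S != finset.set0 ->
  lspan [set phi | exists t : {ffun 'I_d.+1 -> 'I_n},
                    is_max (fun j => h (t j)) phi]
        (setmax h S).
Proof.
have [k] := ubnP #|S|; elim: k S => // k IH S; rewrite ltnS => Sk S0.
have [ltS|leS] := ltnP d.+1 #|S|.
  apply: lspan_trans (setmax_reduction p ltS) => _ [T [TS T0 ->]].
  by apply: IH T0; apply: leq_trans Sk; exact: proper_card.
have /finset.set0Pn [i0 i0S] := S0.
(* the default i0 lies in S, so the surplus places repeat an element of S *)
apply: lspan_mem; exists [ffun j : 'I_d.+1 => nth i0 (enum S) j].
have tS j : nth i0 (enum S) j \in S.
  have [jS|Sj] := ltnP j #|S|; last by rewrite nth_default // -cardE.
  by rewrite -mem_enum mem_nth // -cardE.
move=> x; split=> [j|]; first by rewrite ffunE le_setmax.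
have [i iS ->] := setmax_attained h x i0S.
have lti : (index i (enum S) < d.+1)%N.
  by apply: leq_trans leS; rewrite cardE index_mem mem_enum.
by exists (Ordinal lti); rewrite ffunE nth_index ?mem_enum.
Qed.

End MaxOfAffine.

Section MaxNetwork.
Context {R : realType} {d : nat}.
Local Notation func := ('cV[R]_d -> R).

(** Maxima inside the [r] groups are combinations of the [s ^ (d + 1)] maxima
    of [d + 1] functions each; the logarithmic depth in [r] comes from the
    tournament between the groups. *)
Lemma computable_max_grouped r s (p : 'I_r * 'I_s -> 'cV[R]_d * R) :
  (0 < s)%N ->
  computable (up_log 2 d.+1 + up_log 2 r) (r * s ^ d.+1 * (6 * d.+1) + 6 * r)
    (is_max (fun i => aff (p i))).
Proof.
move=> s0; pose h i := aff (p i); pose j0 := Ordinal s0.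
pose G i := setmax (fun j => h (i, j)) [set: 'I_s]%SET.
pose S (it : 'I_r * {ffun 'I_d.+1 -> 'I_s}) : set func :=
  is_max (fun j => h (it.1, it.2 j)).
have cS it : computable (up_log 2 d.+1) (6 * d.+1) (S it).
  have c0 : computable 0 0 (range h) by move=> _ [i _ <-]; exists (p i).1, (p i).2.
  by apply: (computable_max c0) => j; exists (it.1, it.2 j).
have := computable_lspan (computable_bigU cS).
rewrite card_prod card_ffun !card_ord => cG.
have SG i : lspan (\bigcup_it S it) (G i).
  have S0 : [set: 'I_s]%SET != finset.set0.
    by apply/finset.set0Pn; exists j0; rewrite inE.
  apply: lspan_trans (setmax_lspan (fun j => p (i, j)) S0).
  by move=> phi [t tphi]; apply: lspan_mem; exists (i, t).
apply: computable_sub (computable_max cG SG) => // M maxM x.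
have [Mge [[i j] Mij]] := maxM x; split=> [k|].
  rewrite /G.
  have [l _ ->] := setmax_attained (fun j => h (k, j)) x (finset.in_setT j0).
  exact: Mge.
exists i; apply/le_anti/andP; split.
  by rewrite Mij; apply: (le_setmax (fun j => h (i, j))); rewrite inE.
rewrite /G.
have [l _ ->] := setmax_attained (fun j => h (i, j)) x (finset.in_setT j0).
exact: Mge.
Qed.

End MaxNetwork.
(** * Farkas' lemma *)

Section Farkas.
Context {R : realType} {d : nat}.
Implicit Types (a u x : 'cV[R]_d) (s : seq 'cV[R]_d).

(** Induction on the number of forms.  If the implication fails without the
    first form [u], there is [y] with [u y = 1] and [a y > 0] at which the
    other forms are nonpositive; projecting along [y] onto the kernel of [u]
    eliminates [u], and the sign of [a y] makes its coefficient
    nonnegative. *)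
Lemma farkas s a :
  (forall x, (forall v, v \in s -> dot v x <= 0) -> dot a x <= 0) ->
  exists2 c : nat -> R, forall i, 0 <= c i & a = \sum_(i < size s) c i *: s`_i.
Proof.
have [n] := ubnP (size s); elim: n s a => // n IH [|u s] a; rewrite ltnS => sn Ha.
  exists (fun=> 0) => //; rewrite big_ord0; apply: dot_inj => x.
  have ax : dot a x <= 0 by apply: Ha.
  have : dot a (- x) <= 0 by apply: Ha.
  by rewrite dotNr oppr_le0 dot0l => aNx; apply/le_anti; rewrite ax.
have [Hs|] := pselect (forall x, (forall v, v \in s -> dot v x <= 0) ->
    dot a x <= 0).
  have [c c0 aE] := IH s a sn Hs; exists (fun i => if i is j.+1 then c j else 0).
    by case.
  by rewrite /= big_ord_recl /= scale0r add0r.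
move=> /existsNP [x /not_implyP [sx /negP]]; rewrite -ltNge => ax.
have ux : 0 < dot u x.
  rewrite ltNge; apply/negP => ux; suff : dot a x <= 0 by rewrite leNgt ax.
  by apply: Ha => v; rewrite inE => /predU1P[->|/sx].
pose y := (dot u x)^-1 *: x.
have uy : dot u y = 1 by rewrite dotZr mulVf ?gt_eqF.
have ay : 0 < dot a y by rewrite dotZr mulr_gt0 ?invr_gt0.
have sy v : v \in s -> dot v y <= 0.
  by move=> /sx vx; rewrite dotZr pmulr_rle0 ?invr_gt0.
pose proj (v : 'cV[R]_d) := v - dot v y *: u.
have projE (v z : 'cV[R]_d) : dot (proj v) z = dot v (z - dot u z *: y).
  by rewrite /proj dotBl dotZl dotBr (dotZr (dot u z)) mulrC.
have [||c c0 aE] := IH (map proj s) (proj a).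
- by rewrite size_map.
- move=> t Ht; rewrite projE; apply: Ha => v; rewrite inE => /predU1P[->|vs].
    by rewrite dotBr (dotZr (dot u t)) uy mulr1 subrr.
  by rewrite -projE Ht // map_f.
exists (fun i => if i is j.+1 then c j
                 else dot a y - \sum_(i < size s) c i * dot s`_i y).
  case=> // ; rewrite subr_ge0 (le_trans _ (ltW ay)) // sumr_le0 // => i _.
  by rewrite mulr_ge0_le0 // sy // mem_nth.
rewrite /= big_ord_recl /=; rewrite size_map in aE.
transitivity (proj a + dot a y *: u); first by rewrite subrK.
rewrite aE scalerBl addrC -[RHS]addrA; congr (_ + _).
rewrite scaler_suml -sumrN -big_split /=; apply: eq_bigr => i _.
by rewrite (nth_map (0 : 'cV[R]_d)) // /proj scalerBr scalerA addrC.
Qed.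

(** The form in which Farkas' lemma is used: on a cone, [a] is bounded by a
    multiple of [u] as soon as [a <= 0] wherever [u <= 0]. *)
Lemma farkas_dominate s u a :
  (forall x, (forall v, v \in s -> dot v x <= 0) -> dot u x <= 0 -> dot a x <= 0) ->
  exists2 c, 0 <= c &
    forall x, (forall v, v \in s -> dot v x <= 0) -> dot a x <= c * dot u x.
Proof.
move=> H; have [|c c0 ->] := @farkas (u :: s) a.
  move=> x Hx; apply: H => [v vs|]; apply: Hx; last exact: mem_head.
  by rewrite inE vs orbT.
exists (c 0%N) => // x Hx; rewrite dot_suml /= big_ord_recl dotZl gerDl.
by rewrite sumr_le0 // => i _; rewrite dotZl mulr_ge0_le0 //= Hx // mem_nth // add0n.
Qed.

End Farkas.

(** * From neighbouring cells to all cells *)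

Section SmallSteps.
Context {R : realType}.

Lemma small_forall (T : finType) (P : T -> R -> Prop) :
  (forall t, exists2 e, 0 < e & forall s, 0 < s <= e -> P t s) ->
  exists2 e, 0 < e & forall s, 0 < s <= e -> forall t, P t s.
Proof.
move=> H; have /choice [e He] : forall t, exists e,
    0 < e /\ forall s, 0 < s <= e -> P t s.
  by move=> t; have [e e0 He] := H t; exists e.
exists (\big[Num.min/1]_t e t).
  apply: (big_ind (fun x => 0 < x)) => // [x y x0 y0|t _].
    by rewrite lt_min x0.
  by case: (He t).
move=> s /andP[s0 se] t; apply: (He t).2; rewrite s0 (le_trans se) //.
exact: bigmin_le.
Qed.

Lemma small_lt (a b c : R) : a < b ->
  exists2 e, 0 < e & forall s, 0 < s <= e -> a + s * c < b.
Proof.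
move=> ab; exists ((b - a) / (`|c| + 1)).
  by rewrite divr_gt0 ?subr_gt0 // ltr_pwDr.
move=> s /andP[s0]; rewrite ler_pdivlMr ?ltr_pwDr // => sc.
have : s * c <= s * `|c| by rewrite ler_pM2l // ler_norm.
by lra.
Qed.

End SmallSteps.

Section Domination.
Context {R : realType} {d : nat}.
Implicit Types (x y z w : 'cV[R]_d).

(** The algebraic interior, which for convex sets in finite dimension is the
    topological one. *)
Definition core_point (P : set 'cV[R]_d) y :=
  forall w, exists2 e, 0 < e & P (y + e *: w).

Lemma core_point_mem P y : core_point P y -> P y.
Proof. by move=> /(_ 0) [e _]; rewrite scaler0 addr0. Qed.

Context {I : finType} (g p : I -> 'cV[R]_d * R).

Definition cell k x := forall l, aff (g l) x <= aff (g k) x.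

(** The [p k] are the pieces of a function on the cells of [g]. *)
Hypothesis pE : forall k l x, cell k x -> cell l x -> aff (p k) x = aff (p l) x.

(** At a common point [z] of both cells, only the constraints of cell [k] that
    are active at [z] matter.  In the cone that they define, a direction in
    which [g l] does not fall below [g k] stays in both cells for a small
    step, and there [p k] and [p l] agree; so Farkas' lemma applies to their
    difference. *)
Lemma adjacent_dominate k l z : cell k z -> cell l z ->
  exists2 c, 0 <= c & forall x, cell k x ->
    aff (p l) x - aff (p k) x <= c * (aff (g k) x - aff (g l) x).
Proof.
move=> kz lz; have gz : aff (g k) z = aff (g l) z by apply/le_anti; rewrite kz lz.
have pz := pE kz lz.
(* inactive constraints become the zero form, which constrains nothing *)
pose act m := if aff (g m) z == aff (g k) z then (g m).1 - (g k).1 else 0.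
have [|c c0 Hc] := @farkas_dominate _ _ (codom act) ((g k).1 - (g l).1)
  ((p l).1 - (p k).1).
  move=> w Hw; rewrite !dotBl subr_le0 => glw.
  have {}Hw m : dot (act m) w <= 0 by apply: Hw; exact: codom_f.
  have [e e0 He] : exists2 e, 0 < e & forall s, 0 < s <= e ->
      forall m, aff (g m) (z + s *: w) <= aff (g k) (z + s *: w).
    apply: small_forall => m; have [E|] := eqVneq (aff (g m) z) (aff (g k) z).
      exists 1 => // s /andP[s0 _]; have := Hw m; rewrite /act E eqxx dotBl => Hwm.
      by rewrite !aff_line E lerD2l ler_pM2l // -subr_le0.
    move=> ne; have lt_mk : aff (g m) z < aff (g k) z by rewrite lt_neqAle ne kz.
    have [e e0 He] := small_lt (dot (g m).1 w - dot (g k).1 w) lt_mk.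
    by exists e => // s /He; rewrite !aff_line; lra.
  have kw : cell k (z + e *: w) by apply: He; rewrite e0 lexx.
  have lw : cell l (z + e *: w).
    move=> m; apply: le_trans (kw m) _; rewrite !aff_line gz lerD2l.
    by rewrite ler_pM2l.
  have := pE kw lw; rewrite !aff_line pz => /addrI /(mulfI (lt0r_neq0 e0)) ->.
  by rewrite subrr.
exists c => // x kx; have := Hc (x - z); rewrite !dotBl !dotBr.
have {}Hc : forall v, v \in codom act -> dot v (x - z) <= 0.
  move=> _ /codomP [m ->]; rewrite /act; case: eqP => [E|_]; last by rewrite dot0l.
  by have := kx m; move: E; rewrite /aff dotBl !dotBr; lra.
move=> /(_ Hc); move: gz pz; rewrite /aff => gz pz.
nra.
Qed.

Hypothesis core : forall k, exists y, core_point (cell k) y.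

(** The pieces of [f + c G], where [f] has the pieces [p] and [G] the
    pieces [g]. *)
Definition piece c k x := aff (p k) x + c * aff (g k) x.

Lemma piece_line c k y w t :
  piece c k (y + t *: w) =
  piece c k y + t * (dot (p k).1 w + c * dot (g k).1 w).
Proof. by rewrite /piece !aff_line; ring. Qed.

(** Local to global.  Fix a core point [y] of cell [i] and walk along the
    segment to [x].  The slope of [g] along the segment grows from cell to
    cell, and by the bound for neighbouring cells so does the slope of the
    sum; hence the sum stays above the affine function that it follows near
    [y].  The walk terminates because fewer and fewer pieces have a slope of
    [g] larger than the current one, so that neither continuity nor
    compactness is involved. *)
Lemma pieces_dominate : exists2 c, 0 <= c &
  forall i j x, cell j x -> piece c i x <= piece c j x.
Proof.
have /choice [f Hf] : forall kl : I * I, exists c, 0 <= c /\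
    forall z x, cell kl.1 z -> cell kl.2 z -> cell kl.1 x ->
    aff (p kl.2) x - aff (p kl.1) x <= c * (aff (g kl.1) x - aff (g kl.2) x).
  move=> [k l] /=.
  have [[z [kz lz]]|nz] := pselect (exists z, cell k z /\ cell l z).
    have [c c0 Hc] := adjacent_dominate kz lz.
    by exists c; split=> // z' x _ _; apply: Hc.
  by exists 0; split=> // z x kz lz; case: nz; exists z.
pose c := \sum_kl f kl.
have fc kl : f kl <= c.
  by rewrite /c (bigD1 kl) //= lerDl sumr_ge0 // => ? _; exact: (Hf _).1.
have c0 : 0 <= c by apply: sumr_ge0 => kl _; exact: (Hf kl).1.
have adj k l z x : cell k z -> cell l z -> cell k x -> piece c l x <= piece c k x.
  move=> kz lz kx; have := (Hf (k, l)).2 z x kz lz kx => /= H.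
  have := ler_wpM2r (_ : 0 <= aff (g k) x - aff (g l) x) (fc (k, l)).
  by rewrite subr_ge0 => /(_ (kx l)); rewrite /piece; lra.
have same k l x : cell k x -> cell l x -> piece c k x = piece c l x.
  by move=> kx lx; apply/le_anti; rewrite (adj l k x) // (adj k l x).
exists c => // i j x jx; have [y yi] := core i.
pose w := x - y; pose z t := y + t *: w.
have z1 : z 1 = x by rewrite /z scale1r addrC subrK.
pose sl k := dot (g k).1 w.
pose sp k := dot (p k).1 w + c * dot (g k).1 w.
have gz k t t' : aff (g k) (z t') = aff (g k) (z t) + (t' - t) * sl k.
  by rewrite /z !aff_line /sl; ring.
have hz k t t' : piece c k (z t') = piece c k (z t) + (t' - t) * sp k.
  by rewrite /z !piece_line /sp; ring.
(* The walk has reached the point z t in cell k, which it does not leave at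
   once: every steeper piece is strictly below there. *)
suff walk n k t : (#|[pred l | (sl k < sl l)%R]| < n)%N -> t <= 1 -> cell k (z t) ->
    (forall l, sl k < sl l -> aff (g l) (z t) < aff (g k) (z t)) ->
    piece c i (z t) <= piece c k (z t) -> sp i <= sp k ->
    piece c i x <= piece c j x.
  have i0 : cell i (z 0) by rewrite /z scale0r addr0; exact: core_point_mem.
  apply: (walk _ i 0 (ltnSn _)) => // l il; have [e e0 /(_ l)] := yi w.
  rewrite -[y + _]/(z e) !(gz _ 0 e) subr0 => ?.
  have : e * sl i < e * sl l by rewrite ltr_pM2l.
  by lra.
elim: n k t => // n IH k t; rewrite ltnS => kn t1 kt kst hk sk.
have [kx|/existsNP [l0 /negP]] := pselect (cell k (z 1)).
  rewrite z1 in kx; rewrite -(same _ _ _ kx jx) -z1 !(hz _ t 1).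
  by apply: lerD => //; rewrite ler_wpM2l // subr_ge0.
rewrite -ltNge => l01.
have l0k : sl k < sl l0.
  rewrite ltNge; apply/negP => slk; have := kt l0; move: l01; rewrite !(gz _ t 1).
  by have := ler_wpM2l (_ : 0 <= 1 - t) slk; rewrite subr_ge0 => /(_ t1); lra.
(* the parameter at which the steeper piece l catches up with the piece k *)
pose tau l := t + (aff (g k) (z t) - aff (g l) (z t)) / (sl l - sl k).
have tauE l : sl k < sl l -> aff (g l) (z (tau l)) = aff (g k) (z (tau l)).
  move=> kl; rewrite !(gz _ t (tau l)) /tau.
  have : sl l - sl k != 0 by rewrite subr_eq0 gt_eqF.
  by move=> ?; field.
have gap l s : sl k < sl l ->
    aff (g k) (z s) - aff (g l) (z s) = (tau l - s) * (sl l - sl k).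
  by move=> kl; have := tauE _ kl; rewrite !(gz _ (tau l) s); lra.
have tau_gt l : sl k < sl l -> t < tau l.
  move=> kl; have : 0 < aff (g k) (z t) - aff (g l) (z t) by rewrite subr_gt0 kst.
  by rewrite gap // pmulr_lgt0 subr_gt0.
have [l1 l1k l1min] : exists2 l1, sl k < sl l1 &
    forall l, sl k < sl l -> tau l1 <= tau l.
  have := @Order.TotalTheory.arg_minP _ _ I l0 (fun l => sl k < sl l) tau l0k.
  by case=> l1 ? ?; exists l1.
set t' := tau l1 in l1min; have tt' : t < t' by exact: tau_gt.
have t'1 : t' <= 1.
  apply: le_trans (l1min _ l0k) _.
  rewrite -subr_ge0 -(pmulr_lge0 _ (_ : 0 < sl l0 - sl k)).
    by rewrite -opprB mulNr -gap // oppr_ge0 subr_le0 ltW.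
  by rewrite subr_gt0.
have kt' : cell k (z t').
  move=> l; have [kl|lk] := ltP (sl k) (sl l).
    by rewrite -subr_ge0 gap // mulr_ge0 ?subr_ge0 ?l1min // ltW.
  by rewrite !(gz _ t t') lerD // ler_wpM2l // subr_ge0 ltW.
have l1E : aff (g l1) (z t') == aff (g k) (z t') by rewrite tauE.
(* the steepest piece attaining the maximum at t' is the one to follow *)
have [m mE mmax] : exists2 m, aff (g m) (z t') == aff (g k) (z t') &
    forall l, aff (g l) (z t') == aff (g k) (z t') -> sl l <= sl m.
  case: (@Order.TotalTheory.arg_maxP _ _ I l1
    (fun l => aff (g l) (z t') == aff (g k) (z t')) sl l1E) => m ? ?.
  by exists m.
have km : sl k < sl m := lt_le_trans l1k (mmax l1 l1E).
have mt' : cell m (z t') by move=> l; rewrite (eqP mE).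
have hm := same _ _ _ mt' kt'.
apply: (IH m t') => //.
- apply: leq_trans kn; apply: proper_card; apply/fintype.properP; split.
    by apply/fintype.subsetP => l; rewrite !inE; exact: lt_trans.
  by exists m; rewrite !inE // ltxx.
- move=> l ml; rewrite lt_neqAle mt' andbT; apply/negP.
  by rewrite (eqP mE) => /mmax; rewrite leNgt ml.
- rewrite hm !(hz _ t t') lerD // ler_wpM2l // subr_ge0 ltW //.
- apply: le_trans sk _; have := adj _ _ _ (z t) kt' mt' kt.
  rewrite !(hz _ t' t) hm lerD2l => H.
  have : 0 < t' - t by rewrite subr_gt0.
  by nra.
Qed.

End Domination.
(** * Full-dimensional polyhedra *)

Section Polyhedra.
Context {R : realType} {d : nat}.
Implicit Types (P Q : set 'cV[R]_d) (x y z w : 'cV[R]_d) (p : 'cV[R]_d * R).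

Lemma card_range (U : pointedType) (A : set U) n : (A #= `I_n)%card ->
  exists F : 'I_n -> U, A = range F.
Proof.
rewrite card_eq_sym => /card_set_bijP [f [fA _ sf]].
exists (fun i : 'I_n => f i); apply/seteqP; split=> [u /sf [i ni <-]|_ [i _ <-]].
  by exists (Ordinal ni).
by apply: fA => /=.
Qed.

Definition halfspaces (T : Type) (p : T -> 'cV[R]_d * R) : set 'cV[R]_d :=
  [set x | forall t, aff (p t) x <= 0].

Lemma polyhedronP P : polyhedron P ->
  exists n (p : 'I_n -> 'cV[R]_d * R), P = halfspaces p.
Proof.
move=> [n [A [b ->]]]; exists n, (fun i => ((row i A)^T, - b i 0)).
suff E i x : (aff ((row i A)^T, - b i 0) x <= 0) = ((A *m x) i 0 <= b i 0).
  by apply/seteqP; split=> x /= H i; move: (H i); rewrite E.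
rewrite /aff -[in RHS]subr_le0 mxE; congr (_ + _ <= _).
by apply: eq_bigr => j _; rewrite !mxE.
Qed.

Lemma polyhedron_halfspaces (T : finType) (p : T -> 'cV[R]_d * R) :
  polyhedron (halfspaces p).
Proof.
exists #|T|, (\matrix_(i, j) (p (enum_val i)).1 j 0), (\col_i - (p (enum_val i)).2).
suff E : forall (k : 'I_#|T|) (x : 'cV[R]_d),
    (((\matrix_(i, j) (p (enum_val i)).1 j 0) *m x) k 0 <=
     (\col_i - (p (enum_val i)).2) k 0) = (aff (p (enum_val k)) x <= 0).
  apply/seteqP; split=> x /= H t; first by rewrite E.
  by have := H (enum_rank t); rewrite E enum_rankK.
move=> k x; rewrite !mxE /aff -[LHS]subr_le0 opprK; congr (_ + _ <= _).
by apply: eq_bigr => j _; rewrite !mxE.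
Qed.

(** An average satisfies strictly each inequality that is strict at one of the
    points; this provides relative interior points. *)
Lemma barycenter (T : finType) (X : T -> 'cV[R]_d) (t0 : T) :
  exists y, forall p, (forall t, aff p (X t) <= 0) ->
    aff p y <= 0 /\ ((exists t, aff p (X t) < 0) -> aff p y < 0).
Proof.
have n0 : 0 < #|T|%:R :> R by rewrite ltr0n; apply/card_gt0P; exists t0.
exists (#|T|%:R^-1 *: \sum_t X t) => p pX.
have -> : aff p (#|T|%:R^-1 *: \sum_t X t) = #|T|%:R^-1 * \sum_t aff p (X t).
  rewrite /aff dotZr dot_sumr big_split /= sumr_const mulrDr; congr (_ + _).
  by rewrite -[p.2 *+ _]mulr_natl mulrA mulVf ?mul1r // gt_eqF.
split=> [|[t pt]]; first by rewrite pmulr_rle0 ?invr_gt0 // sumr_le0.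
rewrite pmulr_rlt0 ?invr_gt0 // (bigD1 t) //= ltr_nwDl // sumr_le0 //.
Qed.

(** If no nontrivial constraint is an equality on [P], averaging one strict
    witness for each of them gives a core point. *)
Lemma core_or_flat P : polyhedron P -> P !=set0 ->
  (exists y, core_point P y) \/
  exists p, p.1 != 0 /\ forall x, P x -> aff p x = 0.
Proof.
move=> /polyhedronP [n [p ->]] [x0 Px0].
have [|flat] := pselect (forall i, (p i).1 != 0 ->
    exists2 x, halfspaces p x & aff (p i) x < 0); last first.
  right; move/existsNP: flat => [i /not_implyP [pi0 flat]].
  exists (p i); split=> // x Px.
  apply/le_anti; rewrite Px /= leNgt; apply/negP => lt0; apply: flat; by exists x.
move=> strict; left.
have /choice [X HX] : forall i : 'I_n, exists x, halfspaces p x /\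
    ((p i).1 != 0 -> aff (p i) x < 0).
  move=> i; have [p0|/strict [x Px lt0]] := eqVneq (p i).1 0.
    by exists x0; split=> //; rewrite p0 eqxx.
  by exists x.
have [y Hy] := barycenter (fun o => if o is Some i then X i else x0) None.
exists y => w; suff [e e0 He] : exists2 e, 0 < e & forall s, 0 < s <= e ->
    forall i, aff (p i) (y + s *: w) <= 0.
  by exists e => //; apply: He; rewrite e0 lexx.
apply: small_forall => i.
have [|yle ylt] := Hy (p i); first by move=> [j|]; [exact: (HX j).1|exact: Px0].
have [p0|pn0] := eqVneq (p i).1 0.
  by exists 1 => // s _; rewrite aff_line p0 dot0l mulr0 addr0.
have y0 : aff (p i) y < 0 by apply: ylt; exists (Some i); exact: (HX i).2.
have [e e0 He] := small_lt (dot (p i).1 w) y0.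
by exists e => // s se; rewrite aff_line ltW // He.
Qed.

Lemma core_has_dim P y : core_point P y -> has_dim P d.
Proof.
move=> yP; split; first by exists y; exact: core_point_mem.
exists fullv; last by rewrite dimvf dim_matrix mulr1.
split=> [x z _ _|V HV]; first exact: memvf.
apply/subvP => w _; have [e e0 Pe] := yP w.
have := HV _ _ Pe (core_point_mem yP); rewrite addrAC subrr add0r => we.
by have := memvZ e^-1 we; rewrite scalerA mulVf ?gt_eqF // scale1r.
Qed.

Lemma has_dim_core P : polyhedron P -> has_dim P d -> exists y, core_point P y.
Proof.
move=> polP [P0 [U [_ minU] dimU]].
have [//|[p [p0 Pp]]] := core_or_flat polP P0; exfalso.
pose V := lker (linfun (mulmx p.1^T : 'cV[R]_d -> 'cV[R]_1)).
have VE x : (x \in V) = (dot p.1 x == 0).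
  rewrite memv_ker lfunE /=; have -> : p.1^T *m x = (dot p.1 x)%:M.
    apply/matrixP => i j; rewrite !ord1 !mxE eqxx mulr1n.
    by apply: eq_bigr => k _; rewrite mxE.
  apply/eqP/eqP => [/matrixP/(_ 0 0)|->];
    last by apply/matrixP => i j; rewrite !mxE mul0rn.
  by rewrite !mxE eqxx mulr1n.
have UV : (U <= V)%VS.
  apply: minU => x y /Pp px /Pp py; rewrite VE dotBr.
  by move: px py; rewrite /aff => px py; apply/eqP; lra.
have Vfull : V = fullv.
  have dimf : \dim (fullv : {vspace 'cV[R]_d}) = d.
    by rewrite dimvf dim_matrix mulr1.
  by apply/eqP; rewrite eqEdim subvf dimf; have := dimvS UV; rewrite dimU.
move/eqP: p0; apply; apply: dot_inj => x; rewrite dot0l.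
by apply/eqP; rewrite -VE Vfull memvf.
Qed.

(** A point of the moment curve whose parameter avoids the roots of finitely
    many nonzero polynomials. *)
Lemma generic_direction (T : finType) (a : T -> 'cV[R]_d) :
  exists w, forall t, a t != 0 -> dot (a t) w != 0.
Proof.
pose p : {poly R} := \prod_(t | a t != 0) rVpoly (a t)^T.
have p0 : p != 0.
  apply/prodf_neq0 => t; apply: contraNN => /eqP at0.
  by rewrite -[a t]trmxK -[(a t)^T]rVpolyK at0 raddf0 raddf0.
have [r rp] : exists r, ~~ root p r.
  apply: contrapT => Hp; pose rs := [seq k%:R : R | k <- iota 0 (size p)].
  have : (size rs < size p)%N.
    apply: max_poly_roots => //.
      by apply/allP => r _; apply: contrapT => /negP rp; apply: Hp; exists r.
    rewrite map_inj_uniq ?iota_uniq //; exact: mulrIn (oner_neq0 _).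
  by rewrite size_map size_iota ltnn.
exists (\col_i r ^+ i) => t at0; apply: contraNneq rp => dt.
rewrite /p /root horner_prod (bigD1 t) //= mulf_eq0; apply/orP; left.
rewrite /rVpoly horner_poly; apply/eqP; apply: etrans dt; apply: eq_bigr => i _.
by rewrite valK !mxE.
Qed.

(** Starting from [x], a small step in a generic direction leaves the
    hyperplanes of all flat cells and meets no closed cell that does not
    contain [x]. *)
Lemma full_dim_cover (C : set (set 'cV[R]_d)) x :
  finite_set C -> (forall P, C P -> polyhedron P) -> complete C ->
  exists2 P, full_dim C P & P x.
Proof.
move=> /finite_setP [n /card_range [F FE]]; rewrite {}FE => polC covC.
have polF i : polyhedron (F i) by apply: polC; exists i.
pose flat i p := p.1 != 0 /\ forall x, F i x -> aff p x = 0.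
have /choice [p Hp] : forall i, exists p, (exists p', flat i p') -> flat i p.
  move=> i; have [[p Hp]|nf] := pselect (exists p', flat i p'); first by exists p.
  by exists 0.
have [w Hw] := generic_direction (fun i => (p i).1).
have [e e0 He] : exists2 e, 0 < e & forall s, 0 < s <= e ->
    forall i, F i (x + s *: w) -> F i x /\ exists y, core_point (F i) y.
  apply: small_forall => i.
  have [[z Fz]|F0] := pselect (F i !=set0); last first.
    by exists 1 => // s _ Fs; case: F0; exists (x + s *: w).
  have [core|/Hp [p0 Fp]] := core_or_flat (polF i) (ex_intro _ z Fz).
    have [Fx|nFx] := pselect (F i x); first by exists 1.
    have [m [q FE]] := polyhedronP (polF i).
    move: nFx; rewrite FE => /existsNP [j /negP]; rewrite -ltNge -oppr_lt0 => qx.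
    have [e e0 He] := small_lt (- dot (q j).1 w) qx; exists e => // s se /(_ j).
    by have := He s se; rewrite aff_line; lra.
  have [px0|pxN0] := eqVneq (aff (p i) x) 0.
    exists 1 => // s /andP[s0 _] /Fp/eqP; rewrite aff_line px0 add0r mulf_eq0.
    by rewrite gt_eqF // (negPf (Hw _ p0)).
  case: (ltrgtP (aff (p i) x) 0) pxN0 => // [lt0|gt0] _.
    have [e e0 He] := small_lt (dot (p i).1 w) lt0; exists e => // s /He + /Fp.
    by rewrite aff_line => + E; rewrite E ltxx.
  rewrite -oppr_lt0 in gt0; have [e e0 He] := small_lt (- dot (p i).1 w) gt0.
  by exists e => // s /He + /Fp; rewrite aff_line; lra.
have [_ [i _ <-] Fi] : (\bigcup_(P in range F) P) (x + e *: w) by rewrite covC.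
have [|Fx [y coreF]] := He e _ i Fi; first by rewrite e0 lexx.
by exists (F i) => //; split; [exists i|exact: core_has_dim coreF].
Qed.

Lemma face_set0 P : face set0 P.
Proof.
exists 0, 1; split=> [x _|]; first by rewrite dot0l.
apply/seteqP; split=> // x [_] /=.
by rewrite dot0l => /eqP; rewrite eq_sym oner_eq0.
Qed.

(** If [g x] were smaller than [aff p x], convexity on the segment from [x]
    through [y] to a point of [P] behind [y] would fail at [y]. *)
Lemma convex_above (g : 'cV[R]_d -> R) P y p x : convex_function setT g ->
  core_point P y -> (forall z, P z -> g z = aff p z) -> aff p x <= g x.
Proof.
move=> cvx yP gP; have [e e0 Pe] := yP (y - x).
have e1 : 0 < 1 + e by rewrite addr_gt0.
have t0 : 0 <= (1 + e)^-1 by rewrite invr_ge0 ltW.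
have t1 : (1 + e)^-1 <= 1 by rewrite invf_le1 // lerDl ltW.
pose t := Itv01 t0 t1.
have := cvx t (y + e *: (y - x)) x (in_setT _) (in_setT _).
have -> : conv t (y + e *: (y - x) : convex_lmodType 'cV[R]_d) x = y.
  rewrite /conv /= /unstable.onem; apply/matrixP => i j; rewrite !mxE.
  by field; rewrite gt_eqF.
rewrite convRE /= /unstable.onem (gP _ Pe) (gP _ (core_point_mem yP)).
rewrite aff_line [dot _ _](_ : _ = aff p y - aff p x);
  last by rewrite /aff dotBr; ring.
have : (1 + e)^-1 * (1 + e) = 1 by rewrite mulVf // gt_eqF.
set u := (1 + e)^-1 => ue H.
have u1 : u < 1 by rewrite /u invf_lt1 // ltrDl.
suff : 0 <= (1 - u) * (g x - aff p x) by rewrite pmulr_rge0 ?subr_gt0 // subr_ge0.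
have : u * (aff p y + e * (aff p y - aff p x)) =
    aff p y * (u * (1 + e)) - aff p x * (u * (1 + e) - u) by ring.
by rewrite ue; lra.
Qed.

(** * The cell complex of a maximum of affine functions *)

Section CellComplex.
Context {I : finType} (g : I -> 'cV[R]_d * R).

(** The points at which all pieces in [J] attain the maximum: these sets are
    the nonempty faces of the cells. *)
Definition common_cell (J : {set I}) : set 'cV[R]_d :=
  [set x | forall k, k \in J -> cell g k x].

Definition cell_complex : set (set 'cV[R]_d) :=
  [set Q | Q = set0 \/ exists2 J, J != finset.set0 & Q = common_cell J].

Lemma cell_eq k l x : cell g k x -> cell g l x -> aff (g k) x = aff (g l) x.
Proof. by move=> kx lx; apply/le_anti; rewrite kx lx. Qed.

Lemma cell_trans k l x : cell g k x -> aff (g l) x = aff (g k) x -> cell g l x.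
Proof. by move=> kx E m; rewrite E. Qed.

Lemma common_cell_polyhedron J : polyhedron (common_cell J).
Proof.
pose q (kl : I * I) := if kl.1 \in J then g kl.2 - g kl.1 else 0.
suff -> : common_cell J = halfspaces q by exact: polyhedron_halfspaces.
apply/seteqP; split=> x /= H.
  move=> [k l]; rewrite /q /=; case: ifP => [kJ|_]; last by rewrite aff0.
  by rewrite affB subr_le0; apply: H.
by move=> k kJ l; have := H (k, l); rewrite /q /= kJ affB subr_le0.
Qed.

(** On the cell of [J], the sum over [J'] of the nonpositive functions
    [g k - g j], with a fixed [j] in [J], vanishes exactly on the cell
    of [J']. *)
Lemma common_cell_face_inter (J J' : {set I}) : J != finset.set0 ->
  face (common_cell J `&` common_cell J') (common_cell J).
Proof.
move=> /finset.set0Pn [j jJ].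
pose q := \sum_(k in J') (g k - g j).
have qE x : aff q x = \sum_(k in J') (aff (g k) x - aff (g j) x).
  by rewrite aff_sum; apply: eq_bigr => k _; rewrite affB.
have q0 x : common_cell J x -> aff q x <= 0.
  by move=> Jx; rewrite qE sumr_le0 // => k _; rewrite subr_le0; apply: Jx.
exists q.1, (- q.2); split=> [x /q0|]; first by rewrite /aff; lra.
apply/seteqP; split=> x [Jx] => [J'x|qx]; split=> //=.
  apply/eqP; rewrite -subr_eq0 opprK -[_ + _]/(aff q x) qE big1 // => k kJ'.
  by apply/eqP; rewrite subr_eq0; apply/eqP/cell_eq; [exact: J'x|exact: Jx].
have : aff q x == 0 by rewrite /aff [dot _ _]qx addNr.
rewrite qE -oppr_eq0 -sumrN psumr_eq0 => [/allP H k kJ'|k _].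
  have := H k (mem_index_enum _); rewrite kJ' oppr_eq0 subr_eq0 => /eqP.
  exact/cell_trans/Jx.
by rewrite oppr_ge0 subr_le0; apply: Jx.
Qed.

(** Let [J'] be the set of pieces that attain the maximum on all of [F], and
    [z] an average of witnesses in [F] for the failure of the others.  From
    any point [x] of the cell of [J'] the segment to [z] can be prolonged
    inside the cell of [J]; as the linear form that defines [F] cannot grow
    beyond [z], where it is maximal, it is maximal at [x] too. *)
Lemma face_common_cell (J : {set I}) F : J != finset.set0 ->
  face F (common_cell J) -> cell_complex F.
Proof.
move=> J0 [a [c [ac FE]]]; have [[x0 Fx0]|F0] := pselect (F !=set0); last first.
  by left; apply/seteqP; split=> // x Fx; case: F0; exists x.
right; pose J' := finset (fun k => `[< forall x, F x -> cell g k x >]).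
have J'P k : reflect (forall x, F x -> cell g k x) (k \in J').
  by rewrite inE; exact: asboolP.
have JJ' : J \subset J'.
  by apply/fintype.subsetP => k kJ; apply/J'P => x; rewrite FE => -[Jx _]; exact: Jx.
have [j jJ] : exists j, j \in J by exact/finset.set0Pn.
exists J'; first by apply/finset.set0Pn; exists j; exact: (fintype.subsetP JJ').
apply/seteqP; split=> [x Fx k /J'P|x J'x]; first exact.
have Jx : common_cell J x by move=> k kJ; apply/J'x/(fintype.subsetP JJ').
rewrite FE; split=> //.
have /choice [X HX] : forall k, exists z, F z /\ (k \notin J' -> ~ cell g k z).
  move=> k; have [kJ'|/J'P] := boolP (k \in J'); first by exists x0.
  by move=> /existsNP [z /not_implyP [Fz nz]]; exists z.
have FX k : F (X k) := (HX k).1.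
have [z zP] := barycenter X j.
have hull k : (forall y, F y -> cell g k y) -> cell g k z.
  move=> Fk l; have [t|] := zP (g l - g k); first by rewrite affB subr_le0 Fk.
  by rewrite affB subr_le0.
have az : dot a z = c.
  have eq_c t : dot a (X t) = c by have := FX t; rewrite FE => -[].
  have [t|+ _] := zP (a, - c); first by rewrite /aff /= eq_c subrr.
  have [t|+ _] := zP (- a, c); first by rewrite /aff /= dotNl eq_c addNr.
  by rewrite /aff /= dotNl => ? ?; lra.
have J'z k : k \in J' -> cell g k z by move=> /J'P; exact: hull.
have lt_z l : l \notin J' -> aff (g l) z < aff (g j) z.
  move=> lJ'; have [t|_] := zP (g l - g j).
    by have := FX t; rewrite FE affB subr_le0 => -[Jt _]; apply: Jt.
  rewrite affB subr_lt0; apply; exists l; rewrite affB subr_lt0.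
  have := FX l; rewrite FE => -[Jl _].
  rewrite lt_neqAle (Jl j jJ) andbT; apply/eqP => E.
  by apply: (HX l).2 lJ' _; apply: cell_trans E; exact: Jl.
have same_line l s : l \in J' ->
    aff (g l) (z + s *: (z - x)) = aff (g j) (z + s *: (z - x)).
  move=> lJ'; have jJ' := fintype.subsetP JJ' _ jJ.
  have := cell_eq (J'z _ lJ') (J'z _ jJ'); have := cell_eq (J'x _ lJ') (J'x _ jJ').
  rewrite !aff_line /aff !dotBr => ? ?; nra.
have [e e0 He] : exists2 e, 0 < e & forall s, 0 < s <= e ->
    forall l, aff (g l) (z + s *: (z - x)) <= aff (g j) (z + s *: (z - x)).
  apply: small_forall => l; have [lJ'|lJ'] := boolP (l \in J').
    by exists 1 => // s _; rewrite same_line.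
  have [e e0 He] :=
    small_lt (dot (g l).1 (z - x) - dot (g j).1 (z - x)) (lt_z l lJ').
  by exists e => // s /He; rewrite !aff_line; lra.
have Je : common_cell J (z + e *: (z - x)).
  move=> k kJ; apply: (@cell_trans j); last exact/same_line/(fintype.subsetP JJ').
  by apply: He; rewrite e0 lexx.
have := ac _ Je; rewrite dotDr dotZr dotBr az gerDl pmulr_rle0 // subr_le0 => cx.
by apply/le_anti; rewrite cx ac.
Qed.

Lemma cell_complexP : polyhedral_complex cell_complex.
Proof.
have subset_complex : cell_complex `<=` set0 |` range common_cell.
  by move=> Q [->|[J _ ->]]; [left|right; exists J].
split.
- apply: sub_finite_set subset_complex _; rewrite finite_setU; split=> //.
  exact: finite_image.
- by left.
- move=> _ [->|[J _ ->]]; last exact: common_cell_polyhedron.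
  suff -> : set0 = halfspaces (fun _ : unit => (0, 1)).
    exact: polyhedron_halfspaces.
  by apply/seteqP; split=> // x /(_ tt); rewrite /aff dot0l add0r ler10.
- move=> _ F [->|[J J0 ->]]; last exact: face_common_cell.
  by move=> [a [c [_ ->]]]; left; rewrite set0I.
- move=> _ _ [->|[J J0 ->]] [->|[J' J'0 ->]]; rewrite ?set0I ?setI0;
    try by split; exact: face_set0.
  by split; [|rewrite setIC]; exact: common_cell_face_inter.
Qed.

(** This makes [cell_complex] a competitor against which a coarsest compatible
    complex can be tested. *)
Lemma cell_complex_compatible (f : 'cV[R]_d -> R) :
  (forall x, exists k, cell g k x) ->
  (forall k x, cell g k x -> f x = aff (g k) x) -> compatible f cell_complex.
Proof.
move=> cov fE; split; first exact: cell_complexP.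
  apply/seteqP; split=> // x _; have [k kx] := cov x.
  exists (common_cell (finset.set1 k)).
    right; exists (finset.set1 k) => //.
    by apply/finset.set0Pn; exists k; rewrite finset.set11.
  by move=> l; rewrite finset.in_set1 => /eqP ->.
move=> _ [->|[J /finset.set0Pn [k kJ] ->]]; first by exists 0, 0.
by exists (g k).1, (g k).2 => x Jx; apply: fE; exact: Jx.
Qed.

End CellComplex.

(** * Regular complexes *)

Lemma face_core_eq P Q y : face P Q -> core_point P y -> P = Q.
Proof.
move=> [a [c [_ PE]]] yP; have Pac x : P x -> dot a x = c by rewrite PE => -[].
have a0 : a = 0.
  apply: dot_inj => w; rewrite dot0l; have [e e0 /Pac] := yP w.
  rewrite dotDr dotZr (Pac _ (core_point_mem yP)) => /eqP.
  by rewrite -subr_eq0 addrAC subrr add0r mulf_eq0 gt_eqF //= => /eqP.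
have c0 : c = 0 by rewrite -(Pac _ (core_point_mem yP)) a0 dot0l.
rewrite PE a0 c0; apply/seteqP; split=> [x []|x Qx] //.
by split=> //=; rewrite dot0l.
Qed.

(** The pieces of the convex function [G] on the full-dimensional members [P k]
    are global minorants of [G].  The cell of such a piece belongs to a complex
    compatible with [G], so it lies in a member of the coarsest complex [C];
    this member has the full-dimensional [P k] as a face, hence equals [P k].
    Therefore the cells of the pieces are exactly the [P k], on which [f] is
    affine. *)
Lemma regular_pieces (f : 'cV[R]_d -> R) (C : set (set 'cV[R]_d)) (q : nat) :
  regular C -> compatible f C -> (full_dim C #= `I_q)%card ->
  exists g p : 'I_q -> 'cV[R]_d * R,
    [/\ forall k, exists y, core_point (cell g k) y,
        forall x, exists k, cell g k x
      & forall k x, cell g k x -> f x = aff (p k) x].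
Proof.
move=> [G [_ cvx [[_ _ affG] coarse]]] [[finC _ polC faceC interC] covC afff].
move=> /card_range [P PE].
have PC k : full_dim C (P k) by rewrite PE; exists k.
have /choice [g gP] : forall k, exists p, forall x, P k x -> G x = aff p x.
  by move=> k; have [a [b E]] := affG _ (PC k).1; exists (a, b).
have /choice [p pP] : forall k, exists p, forall x, P k x -> f x = aff p x.
  by move=> k; have [a [b E]] := afff _ (PC k).1; exists (a, b).
have coreP k : exists y, core_point (P k) y.
  exact: has_dim_core (polC _ (PC k).1) (PC k).2.
have gG k x : aff (g k) x <= G x.
  by have [y yP] := coreP k; exact: convex_above cvx yP (gP k).
have covP x : exists k, P k x.
  have [Q] := full_dim_cover x finC polC covC.
  by rewrite PE => -[k _ <-]; exists k.
have Pcell k x : P k x -> cell g k x by move=> kx l; rewrite -(gP k x kx).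
have gE k x : cell g k x -> G x = aff (g k) x.
  move=> kx; have [l lx] := covP x; rewrite (gP l x lx).
  exact: cell_eq (Pcell _ _ lx) kx.
have cov x : exists k, cell g k x by have [k /Pcell kx] := covP x; exists k.
have cellP k x : cell g k x -> P k x.
  have [Q CQ kQ] : exists2 Q, C Q & cell g k `<=` Q.
    have := coarse _ (cell_complex_compatible cov gE).
    move=> /(_ (common_cell g (finset.set1 k))) [|Q CQ sQ].
      right; exists (finset.set1 k) => //.
      by apply/finset.set0Pn; exists k; rewrite finset.set11.
    by exists Q => // y ky; apply: sQ => l; rewrite finset.in_set1 => /eqP ->.
  have PQ : P k `<=` Q by move=> y /Pcell /kQ.
  have [y yP] := coreP k.
  suff -> : P k = Q by exact: kQ.
  apply: face_core_eq yP; rewrite -[X in face X _](setIidl PQ).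
  exact: (interC _ _ (PC k).1 CQ).2.
exists g, p; split=> // [k|k x /cellP]; last exact: pP.
have [y yP] := coreP k; exists y => w; have [e e0 Pe] := yP w.
by exists e => //; exact: Pcell.
Qed.

(** [M1 = f + c G] and [M2 = c G] for the constant [c] of
    [pieces_dominate], where [G] is the convex function with pieces [g]. *)
Lemma regular_difference (f : 'cV[R]_d -> R) (C : set (set 'cV[R]_d)) (q : nat) :
  regular C -> compatible f C -> (full_dim C #= `I_q)%card ->
  exists h1 h2 : 'I_q -> 'cV[R]_d * R, exists M1 M2 : 'cV[R]_d -> R,
    [/\ is_max (fun i => aff (h1 i)) M1, is_max (fun i => aff (h2 i)) M2
      & forall x, f x = M1 x - M2 x].
Proof.
move=> regC compf cardC.
have [g [p [core cov fE]]] := regular_pieces regC compf cardC.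
have pE k l x : cell g k x -> cell g l x -> aff (p k) x = aff (p l) x.
  by move=> kx lx; rewrite -!fE.
have [c c0 dom] := pieces_dominate pE core.
have affZ q' x : aff (c *: q'.1, c * q'.2) x = c * aff q' x.
  by rewrite /aff /= dotZl mulrDr.
pose h2 i : 'cV[R]_d * R := (c *: (g i).1, c * (g i).2).
pose h1 i : 'cV[R]_d * R := ((p i).1 + (h2 i).1, (p i).2 + (h2 i).2).
have h2E i x : aff (h2 i) x = c * aff (g i) x by exact: affZ.
have h1E i x : aff (h1 i) x = piece g p c i x.
  by rewrite /piece -h2E /aff /= dotDl addrACA.
have [k0 _] := cov 0.
have [M1 max1] := is_max_exists (fun i => aff (h1 i)) k0.
have [M2 max2] := is_max_exists (fun i => aff (h2 i)) k0.
exists h1, h2, M1, M2; split=> // x; have [k kx] := cov x.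
have -> : M1 x = piece g p c k x.
  have [ge [i E]] := max1 x; apply/le_anti; rewrite -{2}h1E ge andbT E h1E.
  exact: dom.
have -> : M2 x = c * aff (g k) x.
  have [ge [i E]] := max2 x; apply/le_anti; rewrite -{2}h2E ge andbT E h2E.
  by rewrite ler_wpM2l.
by rewrite (fE k x kx) /piece addrK.
Qed.

End Polyhedra.
(** * Assembling the network *)

(** Dividing by [s] distributes the indices into [r] groups of size [s]; the
    last index fills the remaining places. *)
Lemma computable_max_blocks (R : realType) (d q r s : nat)
    (h : 'I_q -> 'cV[R]_d * R) :
  (0 < s)%N -> (q <= r * s)%N ->
  computable (up_log 2 d.+1 + up_log 2 r) (r * s ^ d.+1 * (6 * d.+1) + 6 * r)
    (is_max (fun i => aff (h i))).
Proof.
case: q h => [|q] h s0 qrs.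
  by apply: computable_sub (computable_set0 _ 0) => // M /(_ 0) [_ [[]]].
pose u (ij : 'I_r * 'I_s) : 'I_q.+1 := inord (minn (ij.1 * s + ij.2) q).
have u_surj k : exists ij, u ij = k.
  have k_lt : (k < r * s)%N := leq_trans (ltn_ord k) qrs.
  have i_lt : (k %/ s < r)%N by rewrite ltn_divLR.
  have j_lt : (k %% s < s)%N by rewrite ltn_mod.
  exists (Ordinal i_lt, Ordinal j_lt); apply/val_inj.
  rewrite /u /= -divn_eq; have := ltn_ord k.
  by rewrite inordK ?ltnS ?geq_minr //; lia.
have := computable_max_grouped (fun ij => h (u ij)) s0.
apply: computable_sub => // M maxM x; have [ge [k Mk]] := maxM x.
split=> [ij|]; first exact: ge.
by have [ij uk] := u_surj k; exists ij; rewrite Mk -uk.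
Qed.

(* up_log 2 n is the ceiling of log_2 n for n > 0; the O-constant K depends
   on the dimension d only. *)
Theorem corollary8p5 (R : realType) (d : nat) :
  exists K : nat,
    forall (f : 'cV[R]_d -> R) (C : set (set 'cV[R]_d)) (q r s : nat),
      cpwl f -> regular C -> compatible f C -> (full_dim C #= `I_q)%card ->
      (0 < r)%N -> (0 < s)%N -> (q <= r * s)%N ->
      exists N : relu_net R d,
        [/\ forall x : 'cV[R]_d, net_eval N x = f x,
            hidden_layers N = (up_log 2 d.+1 + up_log 2 r)%N
          & (net_size N <= K * (r * s ^ d.+1))%N].
Proof.
exists (12 * d.+2)%N => f C q r s _ regC compf cardC r0 s0 qrs.
have [h1 [h2 [M1 [M2 [max1 max2 fE]]]]] := regular_difference regC compf cardC.
have comp_max h := @computable_max_blocks R d q r s h s0 qrs.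
have [N [evN lN sN]] : exists N : relu_net R d,
    [/\ forall x, net_eval N x = f x,
        hidden_layers N = (up_log 2 d.+1 + up_log 2 r)%N
      & (net_size N <= 2 * (r * s ^ d.+1 * (6 * d.+1) + 6 * r))%N].
  apply: computable_net.
  have comp_both := computable_lspan (computableU (comp_max h1) (comp_max h2)).
  apply: computable_sub comp_both.
    by rewrite mul2n addnn.
  move=> _ ->; apply: (lspan_scale_add (c := -1) (phi := M2) (psi := M1)).
  - by apply: lspan_mem; right.
  - by apply: lspan_mem; left.
  - by move=> x; rewrite fE mulN1r addrC.
exists N; split=> //; apply: leq_trans sN _.
have : (r * 1 <= r * s ^ d.+1)%N by rewrite leq_mul2l expn_gt0 s0 orbT.
by rewrite muln1; nia.
Qed.
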